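(* Let $G^{\mathrm{U}}(n,1)$, $n\ge 2$, be the uniform attachment random tree on the vertex set $[n]=\{1,\ldots,n\}$. Then $G^{\mathrm{U}}(n,1)$ obeys the monadic second-order (MSO) 0-1 law: for every MSO sentence $\varphi$ about graphs, the limit $\lim_{n\to\infty}\mathsf{P}\bigl(G^{\mathrm{U}}(n,1)\models\varphi\bigr)$ exists and equals either $0$ or $1$.
   Context: Graphs are finite, simple and undirected. The uniform attachment random tree is defined recursively: $G^{\mathrm{U}}(2,1)$ is the complete graph on $\{1,2\}$ (a single edge). For every $n\ge 2$, $G^{\mathrm{U}}(n+1,1)$ is obtained from $G^{\mathrm{U}}(n,1)$ by adding the vertex $n+1$ and one edge joining $n+1$ to a vertex of $[n]$ chosen uniformly at random (each with probability $1/n$), independently of the previous steps. First-order (FO) sentences about graphs are built from variables $x,y,x_1,\ldots$ (ranging over vertices), logical connectives $\wedge,\vee,\neg,\Rightarrow,\Leftrightarrow$, the binary predicates $\sim$ (adjacency) and $=$ (equality), the quantifiers $\exists,\forall$, and brackets. Vertex labels are not available in the language. Monadic second-order (MSO) sentences are built from the same symbols and, additionally, unary predicate variables $X,Y,X_1,\ldots$ (ranging over subsets of the vertex set), which may also be quantified by $\exists,\forall$; $X(x)$ means that the vertex $x$ belongs to $X$. A sentence has no free variables. $G\models\varphi$ means that $\varphi$ is true on $G$. *)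

(* Defs.v *)
From HB Require Import structures.
From mathcomp Require Import all_boot all_order all_algebra.
From mathcomp Require Import all_classical all_reals all_analysis.

Set Implicit Arguments.
Unset Strict Implicit.
Unset Printing Implicit Defensive.

Import Order.TTheory GRing.Theory Num.Theory.
Import numFieldNormedType.Exports.

Local Open Scope ring_scope.

Definition simple_rel (T : finType) (f : {ffun T * T -> bool}) : bool :=
  [forall x, ~~ f (x, x)] && [forall x, forall y, f (x, y) == f (y, x)].

Record sgraph (T : finType) := SGraph {
  sgraph_val : {ffun T * T -> bool};
  _ : simple_rel sgraph_val }.

HB.instance Definition _ (T : finType) := [isSub for @sgraph_val T].
HB.instance Definition _ (T : finType) := [Countable of sgraph T by <:].
HB.instance Definition _ (T : finType) := [Finite of sgraph T by <:].

Definition adj (T : finType) (g : sgraph T) : rel T :=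
  fun x y => sgraph_val g (x, y).

Lemma simple_rel_of (T : finType) (e : rel T) :
  irreflexive e -> symmetric e -> simple_rel [ffun p => e p.1 p.2].
Proof.
move=> irr sym; apply/andP; split; first by apply/forallP => x; rewrite ffunE irr.
by apply/forallP => x; apply/forallP => y; rewrite !ffunE /= sym.
Qed.

Definition sgraph_of (T : finType) (e : rel T)
    (irr : irreflexive e) (sym : symmetric e) : sgraph T :=
  SGraph (simple_rel_of irr sym).

Lemma adj_sgraph_of (T : finType) (e : rel T)
    (irr : irreflexive e) (sym : symmetric e) : adj (sgraph_of irr sym) =2 e.
Proof. by move=> x y; rewrite /adj /= ffunE. Qed.

Lemma adj_irr (T : finType) (g : sgraph T) : irreflexive (adj g).
Proof. by move=> x; have /andP[/forallP/(_ x)/negbTE] := valP g. Qed.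

Lemma adj_sym (T : finType) (g : sgraph T) : symmetric (adj g).
Proof.
by move=> x y; have /andP[_ /forallP/(_ x)/forallP/(_ y)/eqP] := valP g.
Qed.

Definition complete_rel (T : finType) : rel T := fun x y => x != y.

Lemma complete_rel_irr (T : finType) : irreflexive (@complete_rel T).
Proof. by move=> x; rewrite /complete_rel eqxx. Qed.

Lemma complete_rel_sym (T : finType) : symmetric (@complete_rel T).
Proof. by move=> x y; rewrite /complete_rel eq_sym. Qed.

Definition complete_graph (T : finType) : sgraph T :=
  sgraph_of (@complete_rel_irr T) (@complete_rel_sym T).

(** The vertex set [{1, ..., n}] is encoded as ['I_n], the ordinal [i] standing
    for the vertex [i + 1].  In [attach_rel] the new vertex is
    [ord_max : 'I_n.+1]; the old vertex [x : 'I_n] becomes [lift ord_max x], which has the same numerical value. *)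
Definition attach_rel n (g : sgraph 'I_n) (v : 'I_n) : rel 'I_n.+1 :=
  fun x y =>
    match unlift ord_max x, unlift ord_max y with
    | Some x', Some y' => adj g x' y'
    | Some x', None => x' == v
    | None, Some y' => y' == v
    | None, None => false
    end.

Lemma attach_rel_irr n (g : sgraph 'I_n) (v : 'I_n) :
  irreflexive (attach_rel g v).
Proof.
by move=> x; rewrite /attach_rel; case: (unlift _ x) => // x'; exact: adj_irr.
Qed.

Lemma attach_rel_sym n (g : sgraph 'I_n) (v : 'I_n) :
  symmetric (attach_rel g v).
Proof.
move=> x y; rewrite /attach_rel.
by case: (unlift _ x) (unlift _ y) => [x'|] [y'|] //; exact: adj_sym.
Qed.

Definition attach n (g : sgraph 'I_n) (v : 'I_n) : sgraph 'I_n.+1 :=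
  sgraph_of (attach_rel_irr g v) (attach_rel_sym g v).

(** [ua_law R n] is the probability mass function of the tree on [n.+2]
    vertices, so that the recursion starts from the single edge at [n = 0];
    the vertex [v] is uniform on ['I_n.+2] and independent of [g]. *)
Fixpoint ua_law (R : realType) (n : nat) : sgraph 'I_n.+2 -> R :=
  match n with
  | 0 => fun h => (h == complete_graph 'I_2)%:R
  | m.+1 => fun h =>
      \sum_(g : sgraph 'I_m.+2) \sum_(v : 'I_m.+2 | attach g v == h)
        ua_law R g * (m.+2%:R)^-1
  end.

Definition ua_prob (R : realType) (n : nat) (E : pred (sgraph 'I_n.+2)) : R :=
  \sum_(g | E g) ua_law R g.

Lemma ua_law_ge0 (R : realType) n (h : sgraph 'I_n.+2) : 0 <= ua_law R h.
Proof.
elim: n h => [|n IHn] h /=; first exact: ler0n.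
by apply: sumr_ge0 => g _; apply: sumr_ge0 => v _; rewrite mulr_ge0 ?invr_ge0.
Qed.

Lemma ua_prob_predT (R : realType) n : ua_prob R (n := n) predT = 1.
Proof.
rewrite /ua_prob; elim: n => [|n IHn] /=.
  rewrite (bigD1 (complete_graph 'I_2)) //= eqxx big1 ?addr0 //.
  by move=> h /negbTE ->.
rewrite exchange_big /= -[RHS]IHn; apply: eq_bigr => g _.
transitivity (\sum_(v : 'I_n.+2) ua_law R g * n.+2%:R^-1).
  by rewrite (partition_big (attach g) predT).
rewrite sumr_const card_ord.
by rewrite -mulrnAr -[X in _ * X]mulr_natr mulVf ?mulr1 ?pnatr_eq0.
Qed.

(** Vertex variables and set variables are named by natural numbers, in two
    separate name spaces. *)
Inductive mso : Type :=
  | Adj of nat & nat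
  | Eq of nat & nat
  | Mem of nat & nat    (* [Mem X x] is the atom [X(x)] *)
  | Neg of mso
  | And of mso & mso
  | Or of mso & mso
  | Imp of mso & mso
  | Iff of mso & mso
  | ExV of nat & mso
  | AllV of nat & mso
  | ExS of nat & mso
  | AllS of nat & mso.

Fixpoint free_vars (phi : mso) : seq nat :=
  match phi with
  | Adj x y | Eq x y => [:: x; y]
  | Mem _ x => [:: x]
  | Neg p => free_vars p
  | And p q | Or p q | Imp p q | Iff p q => free_vars p ++ free_vars q
  | ExV x p | AllV x p => [seq y <- free_vars p | y != x]
  | ExS _ p | AllS _ p => free_vars p
  end.

Fixpoint free_sets (phi : mso) : seq nat :=
  match phi with
  | Adj _ _ | Eq _ _ => [::]
  | Mem X _ => [:: X]
  | Neg p => free_sets p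
  | And p q | Or p q | Imp p q | Iff p q => free_sets p ++ free_sets q
  | ExV _ p | AllV _ p => free_sets p
  | ExS X p | AllS X p => [seq Y <- free_sets p | Y != X]
  end.

Definition sentence (phi : mso) : bool :=
  nilp (free_vars phi) && nilp (free_sets phi).

Definition upd (A : Type) (e : nat -> A) (x : nat) (a : A) : nat -> A :=
  fun y => if y == x then a else e y.

Fixpoint holds (T : finType) (g : sgraph T)
    (e : nat -> T) (s : nat -> {set T}) (phi : mso) : bool :=
  match phi with
  | Adj x y => adj g (e x) (e y)
  | Eq x y => e x == e y
  | Mem X x => e x \in s X
  | Neg p => ~~ holds g e s p
  | And p q => holds g e s p && holds g e s q
  | Or p q => holds g e s p || holds g e s q
  | Imp p q => holds g e s p ==> holds g e s q
  | Iff p q => holds g e s p == holds g e s q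
  | ExV x p => [exists a : T, holds g (upd e x a) s p]
  | AllV x p => [forall a : T, holds g (upd e x a) s p]
  | ExS X p => [exists A : {set T}, holds g e (upd s X A) p]
  | AllS X p => [forall A : {set T}, holds g e (upd s X A) p]
  end.

(** The initial assignment is irrelevant for sentences: see [holds_sentence]. *)
Definition models n (g : sgraph 'I_n.+1) (phi : mso) : bool :=
  holds g (fun=> ord0) (fun=> finset.set0) phi.

Lemma eq_holds (T : finType) (g : sgraph T) phi e e' s s' :
  {in free_vars phi, e =1 e'} -> {in free_sets phi, s =1 s'} ->
  holds g e s phi = holds g e' s' phi.
Proof.
have catl (A : Type) (u v : seq nat) (f f' : nat -> A) :
  {in u ++ v, f =1 f'} -> {in u, f =1 f'}.
  by move=> H x xu; apply: H; rewrite mem_cat xu.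
have catr (A : Type) (u v : seq nat) (f f' : nat -> A) :
  {in u ++ v, f =1 f'} -> {in v, f =1 f'}.
  by move=> H x xv; apply: H; rewrite mem_cat xv orbT.
have updE (A : Type) (u : seq nat) x a (f f' : nat -> A) :
  {in [seq y <- u | y != x], f =1 f'} -> {in u, upd f x a =1 upd f' x a}.
  move=> H y yu; rewrite /upd; case: eqVneq => // yx.
  by apply: H; rewrite mem_filter yx.
elim: phi e e' s s' => /= [x y|x y|X x|p IH|p IHp q IHq|p IHp q IHq
  |p IHp q IHq|p IHp q IHq|x p IH|x p IH|X p IH|X p IH] e e' s s' He Hs.
- by rewrite !He // !inE eqxx ?orbT.
- by rewrite !He // !inE eqxx ?orbT.
- by rewrite He ?Hs // inE eqxx.
- by rewrite (IH e e' s s').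
- by rewrite (IHp e e' s s') ?(IHq e e' s s') //; eauto.
- by rewrite (IHp e e' s s') ?(IHq e e' s s') //; eauto.
- by rewrite (IHp e e' s s') ?(IHq e e' s s') //; eauto.
- by rewrite (IHp e e' s s') ?(IHq e e' s s') //; eauto.
- by apply: eq_existsb => a; apply: IH => //; exact: updE.
- by apply: eq_forallb => a; apply: IH => //; exact: updE.
- by apply: eq_existsb => a; apply: IH => //; exact: updE.
- by apply: eq_forallb => a; apply: IH => //; exact: updE.
Qed.

Lemma holds_sentence n (g : sgraph 'I_n.+1) phi e s :
  sentence phi -> holds g e s phi = models g phi.
Proof.
by move=> /andP[/nilP v0 /nilP s0]; apply: eq_holds => x; rewrite ?v0 ?s0.
Qed.

(* Main.v *)
Require Import Defs.
From HB Require Import structures.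
From mathcomp Require Import all_boot all_order all_algebra.
From mathcomp Require Import all_classical all_reals all_analysis.
From mathcomp Require Import ring.

Set Implicit Arguments.
Unset Strict Implicit.
Unset Printing Implicit Defensive.

Import Order.TTheory GRing.Theory Num.Theory.
Import numFieldNormedType.Exports.

(** The rank-[k] MSO types of rooted trees form a finite algebra under the
    operation attaching the root of a second tree to the root of the first.
    This operation satisfies (ab)c = (ac)b, and adding further copies of a
    branch stops mattering after a bounded number of copies; both properties
    pass from an algebra to its power set, which is how types of rank [k + 1]
    arise from types of rank [k].  Hence a root carrying enough branches of
    every type has a type [z] absorbing all further branches.  As truth of a
    sentence does not depend on the root, all trees having a vertex with these
    branches agree on the sentence.

    It remains to see that such a branching occurs with probability tending to
    1.  Deleting the edge between the first two vertices splits the random tree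
    on [n] vertices into two independent ones with uniformly distributed size.
    So the probability [p n] that it does not occur satisfies
    [p n <= (\sum_(1 <= k < n) p k * p (n - k)) / (n - 1)], and since [p n < 1]
    for some [n], this forces [p n] to tend to 0. *)

(** * Finite aperiodic algebras and their power sets *)

Record alg := Alg {
  carrier :> finType;
  op : carrier -> carrier -> carrier;
  op_rcomm : right_commutative op;
  op_aper : exists N, forall a b, iter N.+1 (op^~ b) a = iter N (op^~ b) a }.
Arguments op {a}.

Section PowerAlgebra.
Variable A : alg.

(** Right commutativity lets the first factor be applied last instead, so it can be moved to any
    position. *)
Lemma foldl_op_perm (x : A) s1 s2 :
  perm_eq s1 s2 -> foldl op x s1 = foldl op x s2.
Proof.
have foldl_op b s y : foldl op (op y b) s = op (foldl op y s) b.
  by elim: s y => //= c s IHs y; rewrite op_rcomm IHs.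
elim: s1 s2 x => [|a s1 IHs] s2 x; first by rewrite perm_sym => /perm_nilP ->.
move=> eq12; have as2 : a \in s2 by rewrite -(perm_mem eq12) mem_head.
have rem2 := perm_to_rem as2.
rewrite /= (IHs (rem a s2)); last first.
  by rewrite -(perm_cons a) (perm_trans eq12 rem2).
have {as2} : exists s3 s4, s2 = s3 ++ a :: s4 /\ rem a s2 = s3 ++ s4.
  elim: s2 as2 {eq12 rem2 IHs} => //= b s2 IHs; rewrite inE.
  have [->|nab] := eqVneq a b; first by exists [::], s2.
  by move=> /= /IHs[s3 [s4 [-> ->]]]; exists (b :: s3), s4.
move=> [s3 [s4 [-> ->]]].
by rewrite !foldl_cat /= !foldl_op.
Qed.

Lemma foldl_nseq (x b : A) n : foldl op x (nseq n b) = iter n (op^~ b) x.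
Proof. by elim: n x => //= n IHn x; rewrite IHn -iterSr. Qed.

Lemma count_pigeonhole (s : seq A) N :
  N * #|A| < size s -> exists2 y, y \in s & N < count_mem y s.
Proof.
move=> szs; have [/existsP[y ys]|] := boolP [exists y : A, N < count_mem y s].
  by exists y => //; rewrite -has_pred1 has_count (leq_ltn_trans _ ys).
move=> /existsPn few; suff : size s <= N * #|A| by rewrite leqNgt szs.
have -> : size s = \sum_(y : A) count_mem y s.
  elim: s {szs few} => [|a s IHs] /=; first by rewrite big1.
  rewrite big_split /= -IHs (bigD1 a) //= eqxx big1 ?addn0 //.
  by move=> y; rewrite eq_sym => /negbTE ->.
rewrite mulnC -sum_nat_const; apply: leq_sum => y _.
by rewrite leqNgt.
Qed.

Definition pow_op (X Y : {set A}) : {set A} := op @2: (X, Y).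

Lemma pow_op_rcomm : right_commutative pow_op.
Proof.
have sub X Y Z : pow_op (pow_op X Y) Z \subset pow_op (pow_op X Z) Y.
  apply/fintype.subsetP => _ /imset2P[_ z /imset2P[x y Xx Yy ->] Zz ->].
  by rewrite op_rcomm; do 2?apply: imset2_f.
by move=> X Y Z; apply/eqP; rewrite finset.eqEsubset !sub.
Qed.

Lemma mem_iter_pow_op (X Y : {set A}) n w :
  reflect (exists x ys, [/\ x \in X, size ys = n, all (mem Y) ys
                          & w = foldl op x ys])
          (w \in iter n (pow_op^~ Y) X).
Proof.
apply: (iffP idP).
  elim: n w => [|n IHn] w /=; first by exists w, [::].
  move=> /imset2P[_ y /IHn[x [ys [Xx szys Yys ->]]] Yy ->].
  exists x, (rcons ys y); split=> //; first by rewrite size_rcons szys.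
  - by rewrite all_rcons /= Yy.
  - by rewrite foldl_rcons.
move=> [x [ys [Xx + + ->]]]; elim: n ys => [|n IHn] ys /=.
  by move=> /size0nil ->.
case: (lastP ys) => [//|{}ys y]; rewrite size_rcons all_rcons foldl_rcons.
by move=> [szys] /andP[Yy Yys]; apply: imset2_f => //; apply: IHn.
Qed.

(** In a product of more than [N * #|A|] factors some factor occurs more than
    [N] times, so one copy of it can be added or removed. *)
Lemma pow_op_aper :
  exists N, forall X Y, iter N.+1 (pow_op^~ Y) X = iter N (pow_op^~ Y) X.
Proof.
have [N aper] := op_aper A.
have aperS n a b : N < n ->
    iter n (op^~ b) a = iter n.-1 (op^~ b) a :> A.
  by move=> /subnK <-; rewrite [in RHS]addnS /= !iterD aper.
have group (x y : A) ys : foldl op x ys =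
    iter (count_mem y ys) (op^~ y) (foldl op x [seq z <- ys | predC1 y z]).
  have /permPl peq := perm_filterC (pred1 y) ys.
  rewrite -(foldl_op_perm x peq) -foldl_nseq -foldl_cat.
  apply: foldl_op_perm; rewrite perm_catC perm_cat2l -size_filter.
  by rewrite -(all_pred1P _ _ (filter_all _ _)).
(* One above the pigeonhole bound, so that even the shorter of the two words repeats a factor more
   than [N] times. *)
exists (N * #|A|).+1 => X Y; apply/finset.setP => w.
apply/mem_iter_pow_op/mem_iter_pow_op => -[x [ys [Xx szys Yys ->]]].
- have [|y yys] := @count_pigeonhole ys N; first by rewrite szys ltnW.
  move=> /aperS aperys; exists x, (rem y ys); split=> //.
  + by rewrite size_rem // szys.
  + by apply/allP => z /mem_rem; apply: (allP Yys).
  + rewrite (foldl_op_perm x (perm_to_rem yys)).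
    rewrite (group x y (y :: _)) (group x y (rem y ys)) /= eqxx.
    move: aperys; rewrite (permP (perm_to_rem yys)) /= eqxx /= => aperys.
    exact: aperys.
- have [|y yys] := @count_pigeonhole ys N; first by rewrite szys.
  move=> Ny; exists x, (y :: ys); split=> //.
  + by rewrite /= szys.
  + by rewrite /= Yys andbT; exact: (allP Yys).
  + rewrite (group x y ys) (group x y (y :: ys)) /= eqxx /=.
    by rewrite add0n; apply/esym/(aperS (count_mem y ys).+1)/ltnW.
Qed.

Definition pow_alg : alg := Alg pow_op_rcomm pow_op_aper.

End PowerAlgebra.

(** * Trees and their MSO types *)

(** A binary tree encodes a rooted tree whose vertices are the leaves: [Br t1 t2]
    joins the roots of [t1] and [t2] by an edge and keeps the root of [t1].
    In the recursive tree this is the splitting along the edge between the root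
    and its oldest child. *)
Inductive btree := Leaf | Br of btree & btree.

Fixpoint vert (t : btree) : finType :=
  if t is Br t1 t2 then (vert t1 + vert t2)%type else unit.

Fixpoint root (t : btree) : vert t :=
  match t with Leaf => tt | Br t1 t2 => inl (root t1) end.

Fixpoint tadj (t : btree) : rel (vert t) :=
  match t with
  | Leaf => fun _ _ => false
  | Br t1 t2 => fun x y =>
      match x, y with
      | inl x, inl y => tadj x y
      | inr x, inr y => tadj x y
      | inl x, inr y => (x == root t1) && (y == root t2)
      | inr x, inl y => (x == root t2) && (y == root t1)
      end
  end.

Lemma tadj_irr t : irreflexive (@tadj t).
Proof. by elim: t => [|t1 IH1 t2 IH2] //= [x|x] /=. Qed.

Lemma tadj_sym t : symmetric (@tadj t).
Proof.
by elim: t => [|t1 IH1 t2 IH2] //= [x|x] [y|y] //=; rewrite andbC.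
Qed.

Definition tgraph (t : btree) : sgraph (vert t) :=
  sgraph_of (@tadj_irr t) (@tadj_sym t).

(** For a pair of vertex sets [P], [Q]: whether each contains the root, whether
    each is inhabited, whether they share a vertex, contain two distinct
    vertices, contain two adjacent vertices. *)
Definition atom : finType := (bool * bool * bool * bool * bool * bool * bool)%type.

(** In [Br t1 t2] the root comes from the left; two vertices on opposite sides are always distinct,
    and adjacent only if both are roots. *)
Definition atom_op (u v : atom) : atom :=
  let: (r, r', e, e', m, d, a) := u in
  let: (s, s', f, f', n, c, b) := v in
  (r, r', e || f, e' || f', m || n, [|| d, c, e && f' | f && e'],
   [|| a, b, r && s' | s && r']).

Lemma atom_op_rcomm : right_commutative atom_op.
Proof.
move=> [[[[[[r r'] e] e'] m] d] a] [[[[[[s s'] f] f'] n] c] b].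
move=> [[[[[[s2 s2'] f2] f2'] n2] c2] b2] /=; congr (_, _, _, _, _, _, _).
- by case: e f f2 => [] [] [].
- by case: e' f' f2' => [] [] [].
- by case: m n n2 => [] [] [].
- by case: d c c2 e e' f f2 f' f2' => [] [] [] [] [] [] [] [] [].
- by case: a b b2 r r' s s2 s' s2' => [] [] [] [] [] [] [] [] [].
Qed.

(** The flag for two distinct vertices may become true only at the second copy, with one vertex in
    each copy; every other flag is stable after one. *)
Lemma atom_op_aper u v : iter 3 (atom_op^~ v) u = iter 2 (atom_op^~ v) u.
Proof.
move: u v => [[[[[[r r'] e] e'] m] d] a] [[[[[[s s'] f] f'] n] c] b] /=.
congr (_, _, _, _, _, _, _).
- by case: e f => [] [].
- by case: e' f' => [] [].
- by case: m n => [] [].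
- by case: d c e e' f f' => [] [] [] [] [] [].
- by case: a b r r' s s' => [] [] [] [] [] [].
Qed.

Section AtomAlgebra.
Variable m : nat.
Implicit Types f g : {ffun 'I_m * 'I_m -> atom}.

Definition atoms_op f g : {ffun 'I_m * 'I_m -> atom} :=
  [ffun p => atom_op (f p) (g p)].

Lemma atoms_op_rcomm : right_commutative atoms_op.
Proof. by move=> f g h; apply/ffunP => p; rewrite !ffunE atom_op_rcomm. Qed.

Lemma atoms_op_aper :
  exists N, forall f g, iter N.+1 (atoms_op^~ g) f = iter N (atoms_op^~ g) f.
Proof.
exists 2 => f g; apply/ffunP => p; rewrite /= !ffunE.
exact: (atom_op_aper (f p) (g p)).
Qed.

Definition atoms_alg : alg := Alg atoms_op_rcomm atoms_op_aper.
End AtomAlgebra.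

Fixpoint type_alg (k m : nat) : alg :=
  if k is k'.+1 then pow_alg (type_alg k' m.+1) else atoms_alg m.

Definition meets (T T' : finType) (r : T -> T' -> bool)
    (A : {set T}) (B : {set T'}) : bool :=
  [exists x in A, exists y in B, r x y].

Definition atom_of t (A B : {set vert t}) : atom :=
  (root t \in A, root t \in B, A != finset.set0, B != finset.set0,
   meets eq_op A B, meets (fun x y => x != y) A B, meets (@tadj t) A B).

(** The rank-[k] monadic second-order type of the rooted tree [t] in which the
    sets [P 0], ..., [P (m - 1)] are named. *)
Fixpoint mso_type (k m : nat) t (P : nat -> {set vert t}) : type_alg k m :=
  match k with
  | 0 => [ffun ij : 'I_m * 'I_m => atom_of (P ij.1) (P ij.2)] : type_alg 0 m
  | k'.+1 => (fun A => mso_type k' m.+1 (upd P m A)) @: [set: {set vert t}]%SET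
  end.

Lemma meetsP (T T' : finType) (r : T -> T' -> bool) (A : {set T}) (B : {set T'}) :
  reflect (exists x y, [/\ x \in A, y \in B & r x y]) (meets r A B).
Proof.
apply: (iffP existsP) => [[x /andP[xA /existsP[y /andP[yB rxy]]]]|].
  by exists x, y.
move=> [x [y [xA yB rxy]]]; exists x; rewrite xA; apply/existsP.
by exists y; rewrite yB.
Qed.

Lemma meets_sum (T1 T2 : finType) (r : rel (T1 + T2)) (A B : {set T1 + T2}) :
  meets r A B =
  [|| meets (fun x y => r (inl x) (inl y)) (inl @^-1: A) (inl @^-1: B),
      meets (fun x y => r (inr x) (inr y)) (inr @^-1: A) (inr @^-1: B),
      meets (fun x y => r (inl x) (inr y)) (inl @^-1: A) (inr @^-1: B)
    | meets (fun x y => r (inr x) (inl y)) (inr @^-1: A) (inl @^-1: B)].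
Proof.
apply/meetsP/or4P => [[[x|x] [[y|y] [xA yB rxy]]]|].
- by apply: Or41; apply/meetsP; exists x, y; rewrite !inE.
- by apply: Or43; apply/meetsP; exists x, y; rewrite !inE.
- by apply: Or44; apply/meetsP; exists x, y; rewrite !inE.
- by apply: Or42; apply/meetsP; exists x, y; rewrite !inE.
- case=> /meetsP[x [y []]]; rewrite !inE => xA yB rxy.
  + by exists (inl x), (inl y).
  + by exists (inr x), (inr y).
  + by exists (inl x), (inr y).
  + by exists (inr x), (inl y).
Qed.

Lemma meets_pred (T T' : finType) (a : pred T) (b : pred T')
    (A : {set T}) (B : {set T'}) :
  meets (fun x y => a x && b y) A B = [exists x in A, a x] && [exists y in B, b y].
Proof.
apply/meetsP/andP => [[x [y [xA yB /andP[ax by_]]]]|].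
  by split; apply/existsP; [exists x; rewrite xA|exists y; rewrite yB].
move=> [/existsP[x /andP[xA ax]] /existsP[y /andP[yB by_]]].
by exists x, y; rewrite ax.
Qed.

Lemma exists_in_eq (T : finType) (A : {set T}) x :
  [exists y in A, y == x] = (x \in A).
Proof.
apply/existsP/idP => [[y /andP[yA /eqP <-//]]|xA].
by exists x; rewrite xA /=.
Qed.

Lemma exists_in_true (T : finType) (A : {set T}) :
  [exists y in A, true] = (A != finset.set0).
Proof.
apply/existsP/finset.set0Pn => [[y /andP[yA _]]|[y yA]]; exists y => //.
by rewrite yA.
Qed.

Lemma atom_of_Br t1 t2 (A B : {set vert (Br t1 t2)}) :
  atom_of A B = atom_op (atom_of (inl @^-1: A) (inl @^-1: B))
                        (atom_of (inr @^-1: A) (inr @^-1: B)).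
Proof.
have nempty (C : {set vert t1 + vert t2}) : (C != finset.set0) =
    (inl @^-1: C != finset.set0) || (inr @^-1: C != finset.set0).
  apply/finset.set0Pn/orP => [[[x|x] xC]|[]/finset.set0Pn[x]].
  - by left; apply/finset.set0Pn; exists x; rewrite inE.
  - by right; apply/finset.set0Pn; exists x; rewrite inE.
  - by rewrite inE => xC; exists (inl x).
  - by rewrite inE => xC; exists (inr x).
have ff (T T' : finType) (C : {set T}) (D : {set T'}) :
    meets (fun _ _ => false) C D = false.
  by apply/negbTE/meetsP => -[x [y []]].
have tt' (T T' : finType) (C : {set T}) (D : {set T'}) :
    meets (fun _ _ => true) C D = (C != finset.set0) && (D != finset.set0).
  by rewrite -!exists_in_true -meets_pred.
rewrite /atom_of /atom_op /=; congr (_, _, _, _, _, _, _).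
- by rewrite inE.
- by rewrite inE.
- exact: nempty.
- exact: nempty.
- by rewrite meets_sum /= !ff !orbF.
- by rewrite meets_sum /= !tt'; congr [|| _, _, _ | _]; rewrite andbC.
- rewrite meets_sum /= !meets_pred !exists_in_eq.
  by congr [|| _, _, _ | _]; rewrite andbC.
Qed.

(** A subset of [Br t1 t2] is an arbitrary pair of subsets of the two sides, which is why set
    quantification turns into [pow_op]. This is the composition method of Feferman-Vaught and
    Shelah. *)
Lemma mso_type_Br k m t1 t2 (P : nat -> {set vert (Br t1 t2)}) :
  mso_type k m P = op (mso_type k m (fun i => inl @^-1: P i))
                      (mso_type k m (fun i => inr @^-1: P i)).
Proof.
have updI (T T' : finType) (f : T -> T') (Q : nat -> {set T'}) n A :
    (fun i => f @^-1: upd Q n A i) = upd (fun i => f @^-1: Q i) n (f @^-1: A).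
  by apply: funext => i; rewrite /upd; case: eqP.
elim: k m P => [|k IHk] m P.
  by apply/ffunP => ij; rewrite !ffunE; exact: atom_of_Br.
apply/finset.setP => w; apply/imsetP/imset2P => [[A _ ->]|].
  exists (mso_type k m.+1 (upd (fun i => inl @^-1: P i) m (inl @^-1: A)))
         (mso_type k m.+1 (upd (fun i => inr @^-1: P i) m (inr @^-1: A))).
  - exact: imset_f.
  - exact: imset_f.
  - by rewrite -!updI -IHk.
move=> [_ _ /imsetP[A1 _ ->] /imsetP[A2 _ ->] ->].
pose A : {set vert (Br t1 t2)} :=
  [set x : vert t1 + vert t2 |
     match x with inl y => y \in A1 | inr y => y \in A2 end]%SET.
have <- : inl @^-1: A = A1 by apply/finset.setP => y; rewrite !inE.
have <- : inr @^-1: A = A2 by apply/finset.setP => y; rewrite !inE.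
by exists A => //; rewrite -!updI -IHk.
Qed.

(** One move of the Ehrenfeucht-Fraïssé game, with [B] the answer to [A]. *)
Lemma mso_type_extend k m t t' (P : nat -> {set vert t}) (P' : nat -> {set vert t'}) :
  mso_type k.+1 m P = mso_type k.+1 m P' ->
  forall A, exists B, mso_type k m.+1 (upd P m A) = mso_type k m.+1 (upd P' m B).
Proof.
move=> /finset.setP eqPP' A.
have := eqPP' (mso_type k m.+1 (upd P m A)).
rewrite imset_f // => /esym/imsetP[B _ ->]; by exists B.
Qed.

Lemma mso_type_atom k m t t' (P : nat -> {set vert t}) (P' : nat -> {set vert t'}) i j :
  mso_type k m P = mso_type k m P' -> i < m -> j < m ->
  atom_of (P i) (P j) = atom_of (P' i) (P' j).
Proof.
elim: k m P P' => [|k IHk] m P P' eqPP' im jm.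
  by have /ffunP/(_ (Ordinal im, Ordinal jm)) := eqPP'; rewrite !ffunE.
(* An idle move: the empty set is named only to lower the rank. *)
have [B /IHk] := mso_type_extend eqPP' finset.set0.
by rewrite /upd (ltn_eqF im) (ltn_eqF jm); apply; exact: leqW.
Qed.

Lemma meets_set1 (T T' : finType) (r : T -> T' -> bool) (a : T) (b : T') :
  meets r [set a]%SET [set b]%SET = r a b.
Proof.
apply/meetsP/idP => [[x [y [/set1P-> /set1P->]]] //|rab].
by exists a, b; rewrite !inE.
Qed.

(** The atom of a set paired with itself records whether it is inhabited and whether it has two
    distinct vertices, so it recognizes singletons. *)
Lemma atom_of_set1 t t' (a : vert t) (B : {set vert t'}) :
  atom_of [set a]%SET [set a]%SET = atom_of B B ->
  exists2 b, B = [set b]%SET & (root t == a) = (root t' == b).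
Proof.
rewrite /atom_of !meets_set1 eqxx => -[rB _ B0 _ _ nB _].
have /finset.set0Pn[b bB] : B != finset.set0.
  by rewrite -B0; apply/finset.set0Pn; exists a; rewrite inE.
have EB : B = [set b]%SET.
  apply/finset.setP => x; rewrite inE; apply/idP/eqP => [xB|->//].
  have [//|xb] := eqVneq x b; move: nB; case: meetsP => // -[].
  by exists x, b.
by exists b => //; move: rB; rewrite EB !inE.
Qed.

(** * Types determine truth *)

Fixpoint qdepth (phi : mso) : nat :=
  match phi with
  | Adj _ _ | Eq _ _ | Defs.Mem _ _ => 0
  | Neg p => qdepth p
  | And p q | Or p q | Imp p q | Iff p q => maxn (qdepth p) (qdepth q)
  | ExV _ p | AllV _ p | ExS _ p | AllS _ p => (qdepth p).+1
  end.

(** The variables are interpreted by [e] and [s] among the sets [P 0], ...,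
    [P (m - 1)], vertices being identified with singletons. *)
Definition names (T : finType) (m : nat) (P : nat -> {set T}) e s (vx sx : nat -> nat) :=
  [/\ forall x, vx x < m, forall X, sx X < m,
      forall x, P (vx x) = [set e x]%SET & forall X, P (sx X) = s X].

Lemma names_updv (T : finType) m (P : nat -> {set T}) e s vx sx x a :
  names m P e s vx sx ->
  names m.+1 (upd P m [set a]%SET) (upd e x a) s (upd vx x m) sx.
Proof.
move=> [vm sm eP sP]; split=> [y|X|y|X]; rewrite /upd.
- by case: ifP => // _; apply: leqW.
- exact: leqW.
- by case: (y == x); rewrite ?eqxx // ltn_eqF.
- by rewrite ltn_eqF.
Qed.

Lemma names_upds (T : finType) m (P : nat -> {set T}) e s vx sx X A :
  names m P e s vx sx -> names m.+1 (upd P m A) e (upd s X A) vx (upd sx X m).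
Proof.
move=> [vm sm eP sP]; split=> [y|Y|y|Y]; rewrite /upd.
- exact: leqW.
- by case: ifP => // _; apply: leqW.
- by rewrite ltn_eqF.
- by case: (Y == X); rewrite ?eqxx // ltn_eqF.
Qed.

Section BackAndForth.
Variables (T T' : finType) (f : pred T) (g : pred T').
Hypothesis forth : forall a, exists b, f a = g b.
Hypothesis back : forall b, exists a, g b = f a.

Lemma eq_exists_back_forth : [exists a, f a] = [exists b, g b].
Proof.
apply/existsP/existsP => [[a fa]|[b gb]].
- by have [b fagb] := forth a; exists b; rewrite -fagb.
- by have [a gbfa] := back b; exists a; rewrite -gbfa.
Qed.

Lemma eq_forall_back_forth : [forall a, f a] = [forall b, g b].
Proof.
apply/forallP/forallP => [fT b|gT a].
- by have [a ->] := back b.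
- by have [b ->] := forth a.
Qed.
End BackAndForth.

(** Each quantifier spends one rank; sharing [vx] and [sx] makes the two assignments correspond. *)
Lemma holds_mso_type phi k m t t' (P : nat -> {set vert t}) (P' : nat -> {set vert t'})
    e e' s s' vx sx :
  qdepth phi <= k -> mso_type k m P = mso_type k m P' ->
  names m P e s vx sx -> names m P' e' s' vx sx ->
  holds (tgraph t) e s phi = holds (tgraph t') e' s' phi.
Proof.
have atomE l n u u' (Q : nat -> {set vert u}) (Q' : nat -> {set vert u'})
    f f' r r' vy sy :
    mso_type l n Q = mso_type l n Q' -> names n Q f r vy sy ->
    names n Q' f' r' vy sy ->
    (forall x y, (f x == f y) = (f' x == f' y)) /\
    (forall x y, tadj (f x) (f y) = tadj (f' x) (f' y)) /\
    (forall x X, (f x \in r X) = (f' x \in r' X)).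
  move=> eqQ [vm sm eQ sQ] [_ _ eQ' sQ'].
  split=> [x y|]; last split=> x y.
  - have := mso_type_atom eqQ (vm x) (vm y).
    by rewrite !eQ !eQ' /atom_of !meets_set1 => -[].
  - have := mso_type_atom eqQ (vm x) (vm y).
    by rewrite !eQ !eQ' /atom_of !meets_set1 => -[].
  - have := mso_type_atom eqQ (vm x) (sm y).
    rewrite !eQ !eQ' !sQ !sQ' => -[_ _ _ _ + _ _].
    have meets1 (T : finType) (a : T) (A : {set T}) :
        meets eq_op [set a]%SET A = (a \in A).
      apply/meetsP/idP => [[x1 [y1 [/set1P-> yA /eqP->]]] //|aA].
      by exists a, a; rewrite inE.
    by rewrite !meets1.
(* A vertex quantifier is played as a set move with a singleton, and the answer is then a singleton
   too. *)
have vertE l n u u' (Q : nat -> {set vert u}) (Q' : nat -> {set vert u'})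
    f f' r r' vy sy x p :
    mso_type l.+1 n Q = mso_type l.+1 n Q' -> names n Q f r vy sy ->
    names n Q' f' r' vy sy ->
    (forall R R' h h' vz,
      mso_type l n.+1 R = mso_type l n.+1 R' -> names n.+1 R h r vz sy ->
      names n.+1 R' h' r' vz sy ->
      holds (tgraph u) h r p = holds (tgraph u') h' r' p) ->
    forall a, exists b, holds (tgraph u) (upd f x a) r p
                      = holds (tgraph u') (upd f' x b) r' p.
  move=> eqQ nQ nQ' IH a.
  have [B eqB] := mso_type_extend eqQ [set a]%SET.
  have := mso_type_atom eqB (ltnSn n) (ltnSn n).
  rewrite /upd !eqxx => /atom_of_set1[b Eb _].
  exists b; apply: IH eqB (names_updv x a nQ) _.
  by rewrite Eb; apply: names_updv.
have setE l n u u' (Q : nat -> {set vert u}) (Q' : nat -> {set vert u'})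
    f f' r r' vy sy X p :
    mso_type l.+1 n Q = mso_type l.+1 n Q' -> names n Q f r vy sy ->
    names n Q' f' r' vy sy ->
    (forall R R' z z' sz,
      mso_type l n.+1 R = mso_type l n.+1 R' -> names n.+1 R f z vy sz ->
      names n.+1 R' f' z' vy sz ->
      holds (tgraph u) f z p = holds (tgraph u') f' z' p) ->
    forall A, exists B, holds (tgraph u) f (upd r X A) p
                      = holds (tgraph u') f' (upd r' X B) p.
  move=> eqQ nQ nQ' IH A; have [B eqB] := mso_type_extend eqQ A.
  by exists B; apply: IH eqB (names_upds X A nQ) (names_upds X B nQ').
elim: phi k m t t' P P' e e' s s' vx sx => /=
  [x y|x y|X x|p IH|p IHp q IHq|p IHp q IHq
  |p IHp q IHq|p IHp q IHq|x p IH|x p IH|X p IH|X p IH]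
  k m t t' P P' e e' s s' vx sx.
- by move=> _ eqP nP nP'; rewrite !adj_sgraph_of; apply: (atomE _ _ _ _ _ _ _ _ _ _ _ _ eqP nP nP').2.1.
- by move=> _ eqP nP nP'; apply: (atomE _ _ _ _ _ _ _ _ _ _ _ _ eqP nP nP').1.
- by move=> _ eqP nP nP'; apply: (atomE _ _ _ _ _ _ _ _ _ _ _ _ eqP nP nP').2.2.
- by move=> pk eqP nP nP'; rewrite (IH _ _ _ _ _ _ _ _ _ _ _ _ pk eqP nP nP').
- rewrite geq_max => /andP[pk qk] eqP nP nP'.
  by rewrite (IHp _ _ _ _ _ _ _ _ _ _ _ _ pk eqP nP nP')
             (IHq _ _ _ _ _ _ _ _ _ _ _ _ qk eqP nP nP').
- rewrite geq_max => /andP[pk qk] eqP nP nP'.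
  by rewrite (IHp _ _ _ _ _ _ _ _ _ _ _ _ pk eqP nP nP')
             (IHq _ _ _ _ _ _ _ _ _ _ _ _ qk eqP nP nP').
- rewrite geq_max => /andP[pk qk] eqP nP nP'.
  by rewrite (IHp _ _ _ _ _ _ _ _ _ _ _ _ pk eqP nP nP')
             (IHq _ _ _ _ _ _ _ _ _ _ _ _ qk eqP nP nP').
- rewrite geq_max => /andP[pk qk] eqP nP nP'.
  by rewrite (IHp _ _ _ _ _ _ _ _ _ _ _ _ pk eqP nP nP')
             (IHq _ _ _ _ _ _ _ _ _ _ _ _ qk eqP nP nP').
- case: k => // k; rewrite ltnS => pk eqP nP nP'.
  apply: eq_exists_back_forth.
  + apply: vertE eqP nP nP' _ => R R' h h' vz; exact: IH.
  + apply: vertE (esym eqP) nP' nP _ => R R' h h' vz; exact: IH.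
- case: k => // k; rewrite ltnS => pk eqP nP nP'.
  apply: eq_forall_back_forth.
  + apply: vertE eqP nP nP' _ => R R' h h' vz; exact: IH.
  + apply: vertE (esym eqP) nP' nP _ => R R' h h' vz; exact: IH.
- case: k => // k; rewrite ltnS => pk eqP nP nP'.
  apply: eq_exists_back_forth.
  + apply: setE eqP nP nP' _ => R R' z z' sz; exact: IH.
  + apply: setE (esym eqP) nP' nP _ => R R' z z' sz; exact: IH.
- case: k => // k; rewrite ltnS => pk eqP nP nP'.
  apply: eq_forall_back_forth.
  + apply: setE eqP nP nP' _ => R R' z z' sz; exact: IH.
  + apply: setE (esym eqP) nP' nP _ => R R' z z' sz; exact: IH.
Qed.

Definition tholds (phi : mso) (t : btree) : bool :=
  holds (tgraph t) (fun=> root t) (fun=> [set root t]%SET) phi.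

(** The rank exceeds the quantifier depth by one, so that one move can name the root, which [tholds]
    uses to interpret all variables. *)
Definition sentence_type (phi : mso) (t : btree) : type_alg (qdepth phi).+1 0 :=
  mso_type _ 0 (fun=> finset.set0 : {set vert t}).

Lemma sentence_type_Br phi t1 t2 :
  sentence_type phi (Br t1 t2) =
  op (sentence_type phi t1) (sentence_type phi t2).
Proof.
by rewrite /sentence_type mso_type_Br; congr op; congr mso_type;
  apply: funext => i; rewrite preimset0.
Qed.

Lemma tholds_type phi t t' :
  sentence_type phi t = sentence_type phi t' -> tholds phi t = tholds phi t'.
Proof.
move=> /mso_type_extend/(_ [set root t]%SET)[B eqB].
have := mso_type_atom eqB (ltnSn 0) (ltnSn 0).
rewrite /upd !eqxx => /atom_of_set1[b EB].
rewrite eqxx => /esym/eqP rb.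
apply: (@holds_mso_type phi _ _ _ _ _ _ _ _ _ _ (fun=> 0) (fun=> 0)
          (leqnn _) eqB).
- by split.
- by split=> // x; rewrite /upd eqxx EB rb.
Qed.

(** * Absorbing trees *)

(** Attach to one root enough copies of a representative of each type. *)
Lemma exists_absorbing phi :
  exists Z, forall s, sentence_type phi (Br Z s) = sentence_type phi Z.
Proof.
suff [Z ZP] : exists Z, forall s,
    sentence_type phi s \in enum (type_alg (qdepth phi).+1 0) ->
    sentence_type phi (Br Z s) = sentence_type phi Z.
  by exists Z => s; apply: ZP; rewrite mem_enum.
elim: (enum _) => [|w ws [Z ZP]]; first by exists Leaf.
have [[s0 ws0]|nows] := pselect (exists s, sentence_type phi s = w); last first.
  exists Z => s; rewrite inE => /orP[/eqP ws'|/ZP //].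
  by case: nows; exists s.
have [N aper] := op_aper (type_alg (qdepth phi).+1 0).
have iterE n : sentence_type phi (iter n (Br^~ s0) Z) =
               iter n (op^~ w) (sentence_type phi Z).
  by elim: n => //= n IHn; rewrite sentence_type_Br IHn ws0.
exists (iter N (Br^~ s0) Z) => s; rewrite inE => /orP[/eqP ws'|/ZP sZ].
  by rewrite sentence_type_Br iterE ws'; apply: aper.
rewrite sentence_type_Br iterE; elim: (N) => [|n IHn].
  by rewrite -[RHS]sZ sentence_type_Br.
by rewrite iterS op_rcomm IHn.
Qed.

(** * Isomorphism invariance and change of root *)

Definition giso (T T' : finType) (g : sgraph T) (g' : sgraph T') (h : T -> T') :=
  bijective h /\ forall x y, adj g' (h x) (h y) = adj g x y.

Lemma giso_comp (T T' T'' : finType) (g : sgraph T) (g' : sgraph T')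
    (g'' : sgraph T'') h h' :
  giso g g' h -> giso g' g'' h' -> giso g g'' (h' \o h).
Proof.
move=> [bh hP] [bh' hP']; split; first exact: bij_comp.
by move=> x y; rewrite /= hP' hP.
Qed.

Lemma holds_giso (T T' : finType) (g : sgraph T) (g' : sgraph T') h phi
    e (s : nat -> {set T}) :
  giso g g' h ->
  holds g' (h \o e) (fun X => h @: s X) phi = holds g e s phi.
Proof.
move=> [[h' hK h'K] hP].
have imsetK (B : {set T'}) : h @: (h' @: B) = B.
  by rewrite -imset_comp (eq_imset _ h'K) imset_id.
have hupd f x a : upd (h \o f) x (h a) = h \o upd f x a.
  by apply: funext => y; rewrite /upd /=; case: ifP.
have himupd (f : nat -> {set T}) X (A : {set T}) :
    upd (fun Y => h @: f Y) X (h @: A) = fun Y => h @: upd f X A Y.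
  by apply: funext => y; rewrite /upd /=; case: ifP.
elim: phi e s => /= [x y|x y|X x|p IH|p IHp q IHq|p IHp q IHq
  |p IHp q IHq|p IHp q IHq|x p IH|x p IH|X p IH|X p IH] e s.
- exact: hP.
- exact/can_eq/hK.
- exact/mem_imset/can_inj/hK.
- by rewrite IH.
- by rewrite IHp IHq.
- by rewrite IHp IHq.
- by rewrite IHp IHq.
- by rewrite IHp IHq.
- apply: eq_exists_back_forth => [b|a].
  + by exists (h' b); rewrite -{1}[b]h'K hupd IH.
  + by exists (h a); rewrite hupd IH.
- apply: eq_forall_back_forth => [b|a].
  + by exists (h' b); rewrite -{1}[b]h'K hupd IH.
  + by exists (h a); rewrite hupd IH.
- apply: eq_exists_back_forth => [B|A].
  + by exists (h' @: B); rewrite -{1}[B]imsetK himupd IH.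
  + by exists (h @: A); rewrite himupd IH.
- apply: eq_forall_back_forth => [B|A].
  + by exists (h' @: B); rewrite -{1}[B]imsetK himupd IH.
  + by exists (h @: A); rewrite himupd IH.
Qed.

Lemma holds_tgraph_giso phi t (T : finType) (g : sgraph T) h e s :
  sentence phi -> giso (tgraph t) g h -> holds g e s phi = tholds phi t.
Proof.
move=> /andP[/nilP v0 /nilP s0] gh.
rewrite /tholds -(holds_giso _ _ _ gh).
by apply: Defs.eq_holds => x; rewrite ?v0 ?s0.
Qed.

(** Both trees have the same underlying graph up to isomorphism; only the root moves across the
    joining edge. *)
Lemma tholds_swap phi t1 t2 :
  sentence phi -> tholds phi (Br t1 t2) = tholds phi (Br t2 t1).
Proof.
pose h t t' (x : vert (Br t t')) : vert (Br t' t) :=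
  match x with inl y => inr y | inr y => inl y end.
move=> hphi; rewrite -(@holds_tgraph_giso phi (Br t1 t2) _ (tgraph (Br t2 t1))
  (h t1 t2) (fun=> root (Br t2 t1)) (fun=> [set root (Br t2 t1)]%SET)) //.
split; first by exists (h t2 t1) => -[].
by move=> [x|x] [y|y]; rewrite !adj_sgraph_of.
Qed.

(** Quantifying over the branches added at the root makes the property stable
    under [Br] on either side: in [Br t1 t2] one can move the root across the
    edge to [t2], where [t1] becomes an added branch. *)
Definition good (phi : mso) (Z t : btree) : Prop :=
  forall ss, tholds phi (foldl Br t ss) = tholds phi Z.

Lemma good_absorbing phi Z :
  (forall s, sentence_type phi (Br Z s) = sentence_type phi Z) -> good phi Z Z.
Proof.
move=> absZ ss; apply: tholds_type.
elim/last_ind: ss => //= ss s IHss.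
by rewrite foldl_rcons sentence_type_Br IHss -sentence_type_Br.
Qed.

Lemma good_Brl phi Z t1 t2 : good phi Z t1 -> good phi Z (Br t1 t2).
Proof. by move=> gt1 ss; rewrite (gt1 (t2 :: ss)). Qed.

Lemma good_Brr phi Z t1 t2 :
  sentence phi -> good phi Z t2 -> good phi Z (Br t1 t2).
Proof.
(* All of [ss] is put on [t1], and the result becomes a single branch of [t2]. After the swap, [t2]
   is moved past [ss] by right commutativity. *)
move=> hphi gt2 ss; rewrite -(gt2 [:: foldl Br t1 ss]) /=.
rewrite tholds_swap //; apply: tholds_type.
elim/last_ind: ss => //= ss s IHss.
rewrite !foldl_rcons sentence_type_Br IHss.
by rewrite [in LHS]sentence_type_Br op_rcomm -!sentence_type_Br.
Qed.

(** The left leaf of the new [Br Leaf Leaf] stands for the old vertex: being the root there, it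
    inherits all its former edges. *)
Fixpoint add_leaf (t : btree) : vert t -> btree :=
  match t with
  | Leaf => fun _ => Br Leaf Leaf
  | Br t1 t2 => fun x =>
      match x with
      | inl y => Br (add_leaf y) t2
      | inr y => Br t1 (add_leaf y)
      end
  end.

Definition oattach (T : finType) (r : rel T) (v : T) : rel (option T) :=
  fun x y =>
    match x, y with
    | Some x, Some y => r x y
    | Some x, None => x == v
    | None, Some y => y == v
    | None, None => false
    end.

(** The clause on roots serves the induction, since [Br] places its edge between roots. *)
Lemma add_leaf_oattach t (v : vert t) :
  exists2 h : option (vert t) -> vert (add_leaf v),
    bijective h & h (Some (root t)) = root (add_leaf v) /\
    forall x y, tadj (h x) (h y) = oattach (@tadj t) v x y.
Proof.
elim: t v => [|t1 IH1 t2 IH2] /=.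
  case; exists (fun x => if x is Some _ then inl tt else inr tt).
    by exists (fun x => if x is inl _ then Some tt else None) => [[[]|]|[[]|[]]].
  by split=> // -[[]|] [[]|].
case=> v.
- have [h [h' hK h'K] [hr hP]] := IH1 v.
  exists (fun x => match x with
    | Some (inl x) => inl (h (Some x)) | Some (inr x) => inr x
    | None => inl (h None) end).
    exists (fun x => match x with
      | inl x => if h' x is Some y then Some (inl y) else None
      | inr x => Some (inr x) end) => [[[x|x]|]|[x|x]] //=; rewrite ?hK //.
    by rewrite -[RHS](congr1 _ (h'K x)); case: (h' x).
  split=> [|[[x|x]|] [[y|y]|]] //=; rewrite ?hP ?hr //=;
    by rewrite -hr (can_eq hK) ?andbF.
- have [h [h' hK h'K] [hr hP]] := IH2 v.
  exists (fun x => match x with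
    | Some (inl x) => inl x | Some (inr x) => inr (h (Some x))
    | None => inr (h None) end).
    exists (fun x => match x with
      | inr x => if h' x is Some y then Some (inr y) else None
      | inl x => Some (inl x) end) => [[[x|x]|]|[x|x]] //=; rewrite ?hK //.
    by rewrite -[RHS](congr1 _ (h'K x)); case: (h' x).
  split=> [|[[x|x]|] [[y|y]|]] //=; rewrite ?hP ?hr //=;
    by rewrite -hr (can_eq hK) ?andbF.
Qed.

(** * The recursive tree *)

Local Open Scope classical_set_scope.
Local Open Scope ring_scope.

Lemma sum_ord_ltn (m n : nat) : (\sum_(k < n) (k < m) = minn n m)%N.
Proof.
elim: n => [|n IHn]; first by rewrite big_ord0 min0n.
rewrite big_ord_recr /= IHn; case: ltnP => mn.
  by rewrite (minn_idPl mn) addn1.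
by rewrite (minn_idPr (leqW mn)) addn0.
Qed.

(** The averages [b n] of [p 0], ..., [p n] decrease to a limit [l], and
    [p n <= a] for large [n] with [a < 1]; hence [p] is eventually bounded by
    [a * b] up to [o(1)], and Cesàro's theorem gives [l <= a * l]. *)
Lemma cvg0_self_convolution (R : realType) (p : nat -> R) n0 :
  (forall n, 0 <= p n <= 1) ->
  (forall n, p n.+1 <= n.+1%:R^-1 * \sum_(k < n.+1) p k * p (n - k)%N) ->
  p n0 < 1 -> p n @[n --> \oo] --> 0.
Proof.
move=> p01 pS pn0.
have p0 n : 0 <= p n by have /andP[] := p01 n.
have p1 n : p n <= 1 by have /andP[] := p01 n.
pose b := arithmetic_mean p.
have bE n : b n = n.+1%:R^-1 * \sum_(k < n.+1) p k.
  by rewrite /b /arithmetic_mean /= /series /= big_mkord.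
have b0 n : 0 <= b n.
  by rewrite bE mulr_ge0 // sumr_ge0.
have pb n : p n.+1 <= b n.
  rewrite bE (le_trans (pS n)) // ler_wpM2l //.
  by apply: ler_sum => k _; rewrite ler_piMr.
have bS n : b n.+1 = n.+2%:R^-1 * (n.+1%:R * b n + p n.+1).
  by rewrite !bE mulrA divff ?pnatr_eq0 // mul1r big_ord_recr.
have bdecr : nonincreasing_seq b.
  apply/nonincreasing_seqP => n; rewrite bS ler_pdivrMl //.
  by rewrite -[n.+2]addn1 natrD mulrDl mul1r lerD2l.
have ban : b n0 < 1.
  rewrite bE ltr_pdivrMl // mulr1 big_ord_recr /=.
  rewrite -[n0.+1]addn1 natrD ler_ltD //.
  rewrite (le_trans (ler_sum _ (fun (i : 'I_n0) _ => p1 i))) //.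
  by rewrite sumr_const card_ord.
set a := b n0 in ban.
have pa n : (n0 < n)%N -> p n <= a.
  by case: n => // n n0n; rewrite (le_trans (pb n)) // bdecr.
pose c : R := n0.+1%:R.
(* The indices [k <= n0], where [p k] is only bounded by 1, contribute at most [c = n0 + 1] to the
   sum. *)
have pab n : p n.+1 <= a * b n + c / n.+1%:R.
  rewrite (le_trans (pS n)) // bE mulrCA [c / _]mulrC -mulrDr ler_wpM2l //.
  have rev_sum : \sum_(k < n.+1) p k = \sum_(k < n.+1) p (n - k)%N.
    by rewrite (reindex_inj rev_ord_inj).
  rewrite rev_sum mulr_sumr.
  apply: (@le_trans _ _ (\sum_(k < n.+1) (a * p (n - k)%N + (k < n0.+1)%:R))).
    apply: ler_sum => k _; case: ltnP => [_|n0k].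
      by apply: ler_wpDl; [rewrite mulr_ge0 ?b0 | exact: mulr_ile1].
    by rewrite addr0 ler_wpM2r // pa.
  by rewrite big_split /= lerD2l -natr_sum ler_nat sum_ord_ltn geq_minr.
have bcvg : cvgn b.
  apply: nonincreasing_is_cvgn => //; exists 0 => _ [n _ <-]; exact: b0.
set l := limn b in bcvg *.
have bl : b n @[n --> \oo] --> l by exact: bcvg.
(* The value [c >= 1] at 0 makes [p <= q] hold everywhere, so that their Cesàro means compare. *)
pose q n := if n is n'.+1 then a * b n' + c / n'.+1%:R else c.
have pq n : p n <= q n.
  by case: n => [|n] //=; rewrite (le_trans (p1 0%N)) // /c ler1n.
have ql : q n @[n --> \oo] --> a * l.
  rewrite -cvg_shiftS /= -[a * l]addr0; apply: cvgD.
    exact: cvgMl_tmp.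
  rewrite -[X in _ --> X](mulr0 c); apply: cvgMl_tmp.
  exact: cvg_harmonic.
have lal : l <= a * l.
  have mql := cesaro ql.
  have -> : l = lim (b n @[n --> \oo]) by apply/esym/cvg_lim.
  rewrite -[leRHS](cvg_lim _ mql) //; apply: ler_lim => //.
    by apply/cvg_ex; exists (a * l).
  near=> n; rewrite /b /arithmetic_mean /= ler_wpM2l //.
  by rewrite /series /=; apply: ler_sum => k _; exact: pq.
have l0 : l = 0.
  apply/eqP; rewrite eq_le; apply/andP; split; last first.
    by apply: limr_ge => //; near=> n.
  by move: lal; rewrite -subr_ge0 -{2}[l]mul1r -mulrBl nmulr_rge0 // subr_lt0.
rewrite l0 in bl.
rewrite -cvg_shiftS /=; apply: (squeeze_cvgr _ _ bl); last exact: cvg_cst.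
by near=> n; rewrite p0 pb.
Unshelve. all: by end_near.
Qed.

(** * Expectations over growth histories *)

Section Growth.
Variable R : realType.
Implicit Types f g : btree -> R.

(** Conditional expectation of [f] after one more attachment, multiplied by the number of vertices
    of [t]. *)
Definition grow f (t : btree) : R := \sum_(x : vert t) f (add_leaf x).

(** The sum of [f] over the [n`!] histories leading to a tree with [n.+1]
    vertices. *)
Fixpoint total n f : R := if n is n'.+1 then total n' (grow f) else f Leaf.

(** Expectation of [f] on the recursive tree with [n.+1] vertices. *)
Definition mean n f : R := total n f / n`!%:R.

(** The value at [Leaf] is a default, at which the Leibniz rule [grow_prodf] would fail. *)
Definition prodf f g (t : btree) : R :=
  if t is Br t1 t2 then f t1 * g t2 else 0.

Lemma totalD n f g : total n (fun t => f t + g t) = total n f + total n g.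
Proof.
elim: n f g => [|n IHn] f g //=; rewrite -IHn; congr total.
by apply: funext => t; rewrite /grow big_split.
Qed.

Lemma le_total n f g : (forall t, f t <= g t) -> total n f <= total n g.
Proof.
elim: n f g => [|n IHn] f g fg //=; apply: IHn => t.
exact: ler_sum.
Qed.

(** Adding a leaf never yields [Leaf], so default values there disappear after one step. *)
Lemma grow_le_Br f g : (forall t1 t2, f (Br t1 t2) <= g (Br t1 t2)) ->
  forall t, grow f t <= grow g t.
Proof.
move=> fg [|t1 t2]; apply: ler_sum => x _; first exact: fg.
by case: x => x; apply: fg.
Qed.

Lemma le_totalS n f g : (forall t1 t2, f (Br t1 t2) <= g (Br t1 t2)) ->
  total n.+1 f <= total n.+1 g.
Proof. by move=> fg; exact: (@le_total n _ _ (grow_le_Br fg)). Qed.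

Lemma eq_totalS n f g : (forall t1 t2, f (Br t1 t2) = g (Br t1 t2)) ->
  total n.+1 f = total n.+1 g.
Proof.
by move=> fg; apply/eqP; rewrite eq_le; apply/andP; split;
  apply: le_totalS => t1 t2; rewrite fg.
Qed.

(** Leibniz rule: the new leaf falls into one of the two halves. *)
Lemma grow_prodf f g t1 t2 : grow (prodf f g) (Br t1 t2) =
  prodf (grow f) g (Br t1 t2) + prodf f (grow g) (Br t1 t2).
Proof. by rewrite /grow /= big_sumType /= mulr_suml mulr_sumr. Qed.

(** Pascal's rule, as the induction step of the iterated Leibniz formula. *)
Lemma binomial_convolutionS n (a b : nat -> R) :
  \sum_(k < n.+1) 'C(n, k)%:R * a k.+1 * b (n - k)%N +
  \sum_(k < n.+1) 'C(n, k)%:R * a k * b (n - k).+1 =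
  \sum_(k < n.+2) 'C(n.+1, k)%:R * a k * b (n.+1 - k)%N.
Proof.
rewrite [RHS]big_ord_recl [X in _ + X]big_ord_recl !bin0 !subn0 addrCA.
congr (_ + _).
transitivity (\sum_(k < n.+1) ('C(n, k)%:R * a k.+1 * b (n - k)%N +
                               'C(n, k.+1)%:R * a k.+1 * b (n - k)%N)).
  rewrite [RHS]big_split /=; congr (_ + _).
  rewrite [RHS]big_ord_recr /= bin_small // !mul0r addr0.
  by apply: eq_bigr => k _; rewrite /bump /= add1n subnSK.
apply: eq_bigr => k _.
by rewrite lift0 binS natrD addrC !mulrDl subSS.
Qed.

(** After the first attachment, ['C(n, k)] counts the interleavings of a history of the left half
    with one of the right half. *)
Lemma total_prodf n f g :
  total n.+1 (prodf f g) =
  \sum_(k < n.+1) 'C(n, k)%:R * total k f * total (n - k) g.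
Proof.
elim: n f g => [|n IHn] f g.
  by rewrite big_ord1 /= bin0 mul1r /grow /= big_const card_unit /= addr0.
rewrite -[LHS]/(total n.+1 (grow (prodf f g))).
rewrite [LHS](@eq_totalS n _ (fun t => prodf (grow f) g t + prodf f (grow g) t)
  (grow_prodf f g)) totalD !IHn.
exact: (binomial_convolutionS n (fun k => total k f) (fun k => total k g)).
Qed.

(** The binomial cancels the factorials: the size of a half is uniform, and given the sizes the
    halves are independent recursive trees. *)
Lemma mean_prodf n f g :
  mean n.+1 (prodf f g) = n.+1%:R^-1 * \sum_(k < n.+1) mean k f * mean (n - k) g.
Proof.
rewrite /mean total_prodf factS natrM invfM mulrCA; congr (_ * _).
rewrite mulr_suml; apply: eq_bigr => k _.
have kn : (k <= n)%N by rewrite -ltnS.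
rewrite -(bin_fact kn) !natrM; field.
by rewrite !pnatr_eq0 -!lt0n bin_gt0 kn !fact_gt0.
Qed.

Lemma le_mean n f g : (forall t, f t <= g t) -> mean n f <= mean n g.
Proof. by move=> fg; rewrite ler_wpM2r ?invr_ge0 // le_total. Qed.

Lemma meanD n f g : mean n (fun t => f t + g t) = mean n f + mean n g.
Proof. by rewrite /mean totalD mulrDl. Qed.

Lemma mean1 n : mean n (fun=> 1) = 1.
Proof.
elim/ltn_ind: n => -[|n] IHn; first by rewrite /mean /= divr1.
have -> : mean n.+1 (fun=> 1) = mean n.+1 (prodf (fun=> 1) (fun=> 1)).
  by rewrite /mean (@eq_totalS n _ (prodf (fun=> 1) (fun=> 1))) // => *; rewrite /= mulr1.
rewrite mean_prodf (eq_bigr (fun=> 1)) => [|k _].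
  by rewrite sumr_const card_ord mulVf ?pnatr_eq0.
by rewrite !IHn ?mulr1 // ltnS leq_subr.
Qed.

Lemma mean_cst n c : mean n (fun=> c) = c.
Proof.
have totalZ (f : btree -> R) : total n (fun t => c * f t) = c * total n f.
  elim: n f => [|n IHn] f //=; rewrite -IHn; congr total.
  by apply: funext => t; rewrite /grow mulr_sumr.
rewrite -[RHS]mulr1 -(mean1 n) /mean mulrA -totalZ.
by congr (_ / _); congr total; apply: funext => t; rewrite mulr1.
Qed.

Lemma mean_ge0 n f : (forall t, 0 <= f t) -> 0 <= mean n f.
Proof. by move=> f0; rewrite -(mean_cst n 0) le_mean. Qed.

(** In the product formula only the summand with halves of the sizes of [Z1] and [Z2] is kept; the
    others are nonnegative. *)
Lemma mean_indic_gt0 (Z : btree) : exists n, 0 < mean n (fun t => `[< t = Z >]%:R : R).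
Proof.
elim: Z => [|Z1 [n1 IH1] Z2 [n2 IH2]].
  by exists 0%N; rewrite /mean /= divr1 asboolT.
exists (n1 + n2).+1.
set d1 := (X in mean n1 X) in IH1; set d2 := (X in mean n2 X) in IH2.
set d := (X in mean _ X).
have -> : mean (n1 + n2).+1 d = mean (n1 + n2).+1 (prodf d1 d2).
  rewrite /mean (@eq_totalS _ _ (prodf d1 d2)) // => t1 t2.
  rewrite /d /d1 /d2 /= -natrM mulnb; congr (nat_of_bool _)%:R.
  apply/asboolP/andP => [[-> ->]|[/asboolP-> /asboolP->]] //.
  by split; apply/asboolP.
rewrite mean_prodf mulr_gt0 ?invr_gt0 //.
have lt1 : (n1 < (n1 + n2).+1)%N by rewrite ltnS leq_addr.
rewrite (bigD1 (Ordinal lt1)) //= ltr_wpDr //.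
  by apply: sumr_ge0 => k _; rewrite mulr_ge0 // mean_ge0 // => t; rewrite ler0n.
by rewrite addKn mulr_gt0.
Qed.

Lemma mean_indic_cvg0 (bad : pred btree) (Z : btree) :
  ~~ bad Z -> (forall t1 t2, bad (Br t1 t2) -> bad t1 && bad t2) ->
  mean n (fun t => (bad t)%:R : R) @[n --> \oo] --> 0.
Proof.
move=> nbadZ badBr.
have [n0 n0P] := mean_indic_gt0 Z.
apply: (@cvg0_self_convolution _ _ n0) => [n|n|].
- rewrite mean_ge0 => [|t]; last by rewrite ler0n.
  by rewrite -{2}(mean1 n) le_mean // => t; rewrite lern1 leq_b1.
- rewrite -mean_prodf ler_wpM2r ?invr_ge0 //.
  apply: le_totalS => t1 t2 /=; rewrite -natrM ler_nat mulnb.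
  by case: (bad (Br _ _)) (badBr t1 t2) => // ->.
(* [Z] has positive probability and is not bad: adding its indicator strictly increases the mean,
   yet the sum stays at most 1. *)
- rewrite -[ltRHS](mean1 n0).
  rewrite (@lt_le_trans _ _ (mean n0 (fun t => (bad t)%:R + `[< t = Z >]%:R))) //.
    by rewrite meanD ltrDl.
  apply: le_mean => t; case: asboolP => [->|_]; first by rewrite (negbTE nbadZ) add0r.
  by rewrite addr0 lern1 leq_b1.
Qed.

(** * Transfer to the law of the random tree *)

Lemma attach_giso n (g : sgraph 'I_n.+1) t (v : vert t) h :
  giso (tgraph t) g h ->
  exists h', giso (tgraph (add_leaf v)) (attach g (h v)) h'.
Proof.
move=> [bh hP]; have [i [i' iK i'K] [_ iP]] := add_leaf_oattach v.
pose j (x : option (vert t)) : 'I_n.+2 :=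
  if x is Some y then lift ord_max (h y) else ord_max.
exists (j \o i'); split.
  apply: bij_comp; last by exists i.
  have [k hK kh] := bh.
  exists (fun x => omap k (unlift ord_max x)) => [[x|]|x] /=.
  - by rewrite liftK /= hK.
  - by rewrite unlift_none.
  - by case: unliftP => [y ->|->] //=; rewrite kh.
move=> x y; rewrite /= -[x in RHS]i'K -[y in RHS]i'K !adj_sgraph_of iP.
rewrite /attach_rel.
case: (i' x) (i' y) => [a|] [b|] /=; rewrite ?liftK ?unlift_none //.
- by rewrite hP adj_sgraph_of.
- by rewrite (inj_eq (bij_inj bh)).
- by rewrite (inj_eq (bij_inj bh)).
Qed.

(** Summing out the last attachment turns [F] into [F1], which corresponds to [grow f]; the factors
    [1 / n.+2] accumulate to the factorial in [mean]. *)
Lemma sum_ua_law_mean n (F : sgraph 'I_n.+2 -> R) f :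
  (forall t (g : sgraph 'I_n.+2) h, giso (tgraph t) g h -> F g = f t) ->
  \sum_(g : sgraph 'I_n.+2) ua_law R g * F g = mean n.+1 f.
Proof.
elim: n F f => [|n IHn] F f Ff.
  rewrite (bigD1 (complete_graph 'I_2)) //= eqxx mul1r big1 => [|g /negbTE->].
    rewrite addr0 /mean /= divr1 /grow /= big_const card_unit /= addr0.
    pose h (x : vert (Br Leaf Leaf)) : 'I_2 := if x is inl _ then ord0 else ord_max.
    apply: (Ff _ _ h); split.
      exists (fun i => if i == ord0 then inl tt else inr tt) => [[[]|[]]|x] //=.
      by case: ifPn => [/eqP->|] //; case: x => [[|[|]]] // i ?; apply: val_inj.
    by move=> [[]|[]] [[]|[]]; rewrite !adj_sgraph_of.
  by rewrite mul0r.
pose F1 (g : sgraph 'I_n.+2) : R := \sum_(v : 'I_n.+2) F (attach g v).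
transitivity (n.+2%:R^-1 * \sum_(g : sgraph 'I_n.+2) ua_law R g * F1 g).
  under eq_bigr => h _ do rewrite /= mulr_suml.
  rewrite exchange_big mulr_sumr; apply: eq_bigr => g _.
  rewrite /F1 mulrCA mulr_sumr mulr_sumr (partition_big (attach g) predT) //=.
  apply: eq_bigr => h _; rewrite mulr_suml; apply: eq_bigr => v /eqP <-.
  by rewrite mulrA.
rewrite (IHn F1 (grow f)) => [|t g h gh].
  rewrite /mean [n.+2`!]factS natrM invfM mulrCA.
  by rewrite /= mulrA [_ * _^-1]mulrC.
rewrite /F1 /grow (reindex h) /=; last by case: gh => bh _; apply: onW_bij.
apply: eq_bigr => v _; have [h' gh'] := attach_giso v gh.
exact: Ff gh'.
Qed.

End Growth.

Theorem theorem1 (R : realType) (phi : mso) (hphi : sentence phi) :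
  exists l : R, (l = 0 \/ l = 1) /\
    ua_prob R (fun g : sgraph 'I_n.+2 => models g phi) @[n --> \oo] --> l.
Proof.
have [Z absZ] := exists_absorbing phi.
exists (tholds phi Z)%:R; split; first by case: tholds; [right|left].
have -> : (fun n => ua_prob R (fun g : sgraph 'I_n.+2 => models g phi)) =
          (fun n => mean n.+1 (fun t => (tholds phi t)%:R : R)).
  apply: funext => n; rewrite -(@sum_ua_law_mean R n (fun g => (models g phi)%:R)).
    rewrite /ua_prob big_mkcond; apply: eq_bigr => g _.
    by case: models; rewrite ?mulr1 ?mulr0.
  by move=> t g h gh; rewrite /models (holds_tgraph_giso _ _ hphi gh).
have badBr t1 t2 : `[< ~ good phi Z (Br t1 t2) >] ->
    `[< ~ good phi Z t1 >] && `[< ~ good phi Z t2 >].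
  move=> /asboolP bad; apply/andP; split; apply/asboolP => gt; apply: bad.
    exact: good_Brl.
  exact: good_Brr.
have nbadZ : ~~ `[< ~ good phi Z Z >].
  by apply/asboolP; apply; exact: good_absorbing.
have := @mean_indic_cvg0 R (fun t => `[< ~ good phi Z t >]) Z nbadZ badBr.
rewrite -cvg_shiftS /= => badcvg.
pose c : R := (tholds phi Z)%:R.
have upper : mean n.+1 (fun t => `[< ~ good phi Z t >]%:R : R) + c
    @[n --> \oo] --> c.
  by rewrite -[X in _ --> X]add0r; apply: cvgD => //; exact: cvg_cst.
have lower : c - mean n.+1 (fun t => `[< ~ good phi Z t >]%:R : R)
    @[n --> \oo] --> c.
  by rewrite -[X in _ --> X]subr0; apply: cvgB => //; exact: cvg_cst.
apply: squeeze_cvgr lower upper; near=> n.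
(* The empty list of added branches shows that a good tree agrees with [Z] on [phi]. *)
have close t : `|(tholds phi t)%:R - c| <= `[< ~ good phi Z t >]%:R.
  rewrite /c; case: asboolP => [_|/contrapT/(_ [::])/= ->].
    by case: (tholds phi t) (tholds phi Z) => [] [];
      rewrite ?subrr ?normr0 ?subr0 ?sub0r ?normrN ?normr1.
  by rewrite subrr normr0.
apply/andP; split.
- rewrite lerBlDr -meanD -[leLHS](mean_cst n.+1).
  apply: le_mean => t; rewrite addrC -lerBlDr.
  by rewrite (le_trans _ (close t)) // distrC ler_norm.
- rewrite -[X in _ + X](mean_cst n.+1) -meanD; apply: le_mean => t.
  by rewrite -lerBlDr (le_trans _ (close t)) // ler_norm.
Unshelve. all: by end_near.
Qed.
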